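(* Let $a:\mathbb{N}\to\mathbb{C}$ be a bounded arithmetic function whose average $A=\lim_{N\to\infty}\frac1N\sum_{n=1}^N a(n)$ exists, and suppose that this average is invariant under multiplications, i.e. for every $m\in\mathbb{N}$, $$\lim_{N\to\infty}\frac1N\sum_{n=1}^N a(mn)=\lim_{N\to\infty}\frac1N\sum_{n=1}^N a(n)=A .$$ Let $\mathcal{S}$ be a finite set of primes. Then $$\lim_{N\to\infty}\frac1N\sum_{\substack{1\le n\le N\\ n\ \text{squarefree}\\ p\,\nmid\, n\ \forall p\in\mathcal{S}}} a(n)=\frac{\alpha(\mathcal{S})}{\zeta(2)}\,A,\qquad\text{where } \alpha(\mathcal{S})=\prod_{p\in\mathcal{S}}\frac{p}{p+1}.$$ In particular, if $\mathcal{S}=\emptyset$, then $$\lim_{N\to\infty}\frac1N\sum_{\substack{1\le n\le N\\ n\ \text{squarefree}}} a(n)=\frac{6}{\pi^2}\,A.$$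
   Context: $\mathbb{N}=\{1,2,3,\dots\}$. $\zeta$ is the Riemann zeta function, so $\zeta(2)=\pi^2/6$. An integer $n\ge1$ is squarefree if no prime square divides it ($1$ is squarefree). Empty products equal $1$. *)

(* Defs.v *)
From HB Require Import structures.
From mathcomp Require Import all_boot all_order all_algebra finmap.
From mathcomp Require Import all_classical all_reals all_analysis.
From mathcomp Require Import complex.

Set Implicit Arguments.
Unset Strict Implicit.
Unset Printing Implicit Defensive.

Import Order.TTheory GRing.Theory Num.Theory.
Import numFieldNormedType.Exports.

Local Open Scope classical_set_scope.
Local Open Scope ring_scope.
Local Open Scope complex_scope.

(* Arithmetic functions on {1, 2, 3, ...} are encoded as functions on [nat];
   their value at 0 is never used. *)

Definition squarefree (n : nat) : Prop :=
  (0 < n)%N /\ forall p : nat, prime p -> ~~ (p ^ 2 %| n)%N.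

(* [average P a N] is (1/N) times the sum of a(n) over 1 <= n <= N with P n.
   The codomain [(R[i])^o] is [R[i]] seen as a normed space over itself, which
   is what carries the topology of the complex plane. *)
Definition average (R : realType) (P : nat -> Prop) (a : nat -> R[i]) (N : nat)
    : (R[i])^o :=
  N%:R^-1 * \sum_(1 <= n < N.+1 | `[< P n >]) a n.

(* Riemann zeta on the half-line s > 1, by its Dirichlet series
   (the k-th term of the series is (k + 1)^(-s)). *)
Definition zeta (R : realType) (s : R) : R :=
  limn (series (fun k : nat => k.+1%:R `^ (- s) : R)).

Definition alpha (R : realType) (S : {fset nat}) : R :=
  \prod_(p <- S) (p%:R / (p%:R + 1)).

(* Main.v *)
Require Import Defs.
From HB Require Import structures.
From mathcomp Require Import all_boot all_order all_algebra finmap.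
From mathcomp Require Import all_classical all_reals all_analysis.
From mathcomp Require Import complex ring lra zify.

Set Implicit Arguments.
Unset Strict Implicit.
Unset Printing Implicit Defensive.

Import Order.TTheory GRing.Theory Num.Theory.
Import numFieldNormedType.Exports.

Local Open Scope classical_set_scope.
Local Open Scope ring_scope.
Local Open Scope complex_scope.

(** The condition that n is squarefree and prime to S says that n avoids the
    pairwise coprime moduli p (for p in S) and p ^ 2 (for the other primes).
    Keep only the moduli coming from the primes p <= z.  Removing the multiples
    of one more modulus e from a sieved average subtracts the same sieved
    average of n |-> a (e n), taken up to N / e; the function n |-> a (e n) has
    the same multiplication-invariant average A, so every step multiplies the
    limit by 1 - 1/e ([cvg_average_sieved]).  For a finite list of moduli the
    limit is therefore A times the product of the 1 - 1/d.

    Passing to all primes costs the n <= N divisible by some k ^ 2 with k > z;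
    they are at most N / z in number, so by boundedness of a the truncated
    averages are within M / z of the full one, uniformly in N
    ([average_sieve_error]).  Hence the two limits can be exchanged
    ([cvg_uniform_approx]).

    The truncated products tend to alpha(S) / zeta(2), because
    (1 - 1/p) / (1 - 1/p^2) = p / (p + 1) and because of the Euler product at 2.
    The latter follows from the same sieve identity applied to n |-> 1/n^2:
    zeta(2) times the product over p <= z is the sum of 1/n^2 over the n
    without prime factor <= z, which lies between 1 and 1 + 1/z.

    For S empty the value zeta(2) = pi^2/6 is needed as well.  It comes from the
    closed form of the sum of 1 / sin(x)^2 over dyadic angles x, obtained from
    the duplication formula, and from 1/x^2 <= 1/sin(x)^2 <= 1 + 1/x^2. *)

(** * The value of zeta at 2 *)

Lemma pihalf_gt0 (R : realType) : 0 < pi / 2 :> R.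
Proof. by rewrite divr_gt0 ?pi_gt0. Qed.

Lemma cos_gt0_quadrant (R : realType) (x : R) : 0 <= x < pi / 2 -> 0 < cos x.
Proof.
move=> /andP[x0 xpi]; apply: cos_gt0_pihalf.
by rewrite xpi andbT (lt_le_trans _ x0)// oppr_lt0 pihalf_gt0.
Qed.

Lemma sin_le_id (R : realType) (x : R) : 0 < x -> sin x <= x.
Proof.
move=> x0.
have [|c _] := MVT x0 (fun t _ => is_derive_sin t).
  by apply: continuous_subspaceT => t; exact: continuous_sin.
by rewrite sin0 !subr0 => ->; rewrite ger_pMl// cos_le1.
Qed.

Lemma id_le_tan (R : realType) (x : R) : 0 < x < pi / 2 -> x <= tan x.
Proof.
move=> /andP[x0 xpi].
have cos_pos t : t \in `[0, x] -> 0 < cos t.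
  rewrite in_itv/= => /andP[t0 tx]; apply: cos_gt0_quadrant.
  by rewrite t0 (le_lt_trans tx xpi).
have tan_derive t : t \in `]0, x[ -> is_derive t 1 tan ((cos t)^-2).
  by move=> /subset_itv_oo_cc/cos_pos ct; apply: is_derive_tan; rewrite gt_eqF.
have [|c /subset_itv_oo_cc c0x] := MVT x0 tan_derive.
  apply: continuous_in_subspaceT => t; rewrite inE => /= /cos_pos ct.
  by apply: continuous_tan; rewrite gt_eqF.
rewrite tan0 !subr0 => ->; rewrite ler_pMl// invf_ge1 ?exprn_gt0 ?cos_pos//.
Qed.

(** This is sin x <= x <= tan x, rewritten with 1/sin^2 = 1 + 1/tan^2. *)
Lemma csc2_bounds (R : realType) (x : R) : 0 < x < pi / 2 ->
  x ^- 2 <= sin x ^- 2 <= 1 + x ^- 2.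
Proof.
move=> xI; have /andP[x0 xpi] := xI.
have sx : 0 < sin x by apply: sin_gt0_pihalf.
have cx : 0 < cos x by rewrite cos_gt0_quadrant// ltW.
have csc_cot : sin x ^- 2 = 1 + tan x ^- 2.
  transitivity ((cos x ^+ 2 + sin x ^+ 2) / sin x ^+ 2).
    by rewrite cos2Dsin2 mul1r.
  by rewrite /tan; field; rewrite !gt_eqF.
have antitone (u v : R) : 0 < u -> u <= v -> v ^- 2 <= u ^- 2.
  move=> u0 uv; have v0 := lt_le_trans u0 uv.
  by rewrite lef_pV2 ?posrE ?exprn_gt0// lerXn2r// nnegrE ltW.
by rewrite antitone ?sin_le_id//= csc_cot lerD2l antitone ?id_le_tan.
Qed.

(** The left-hand side is 1/sin^2 + 1/cos^2 = 1/(sin cos)^2. *)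
Lemma csc2_duplication (R : realType) (x : R) : 0 < x < pi / 2 ->
  sin x ^- 2 + sin (pi / 2 - x) ^- 2 = 4 * sin (x *+ 2) ^- 2.
Proof.
move=> xI; have /andP[x0 xpi] := xI.
have sx : 0 < sin x by apply: sin_gt0_pihalf.
have cx : 0 < cos x by rewrite cos_gt0_quadrant// ltW.
rewrite addrC [pi / 2 - x]addrC sinDpihalf cosN sin_mulr2n.
transitivity ((cos x ^+ 2 + sin x ^+ 2) / (cos x * sin x) ^+ 2).
  by field; rewrite !gt_eqF.
by rewrite cos2Dsin2 -mulr_natl; field; rewrite !gt_eqF.
Qed.

Lemma sum_nat_reflect (V : nmodType) (f : nat -> V) (n : nat) :
  \sum_(1 <= k < n) f k = \sum_(1 <= k < n) f (n - k)%N.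
Proof.
case: n => [|n]; first by rewrite !big_geq.
by rewrite big_nat_rev/=.
Qed.

(** The angles are the multiples of a dyadic fraction of pi lying strictly
    inside the first quadrant: doubling the angles of level n + 1 gives those of
    level n, their mirror images in pi / 2, and pi / 2 itself. *)
Definition dyadic_csc2 (R : realType) (n : nat) : R :=
  \sum_(1 <= k < 2 ^ n) sin (k%:R * pi / 2 ^+ n.+1) ^- 2.

Lemma dyadic_angle (R : realType) (n k : nat) : (0 < k < 2 ^ n)%N ->
  0 < k%:R * (pi : R) / 2 ^+ n.+1 < pi / 2.
Proof.
move=> /andP[k0 kn]; have p2 : 0 < 2 ^+ n :> R by rewrite exprn_gt0.
rewrite divr_gt0 ?mulr_gt0 ?ltr0n ?pi_gt0 ?exprn_gt0//=.
have -> : k%:R * pi / 2 ^+ n.+1 = k%:R / 2 ^+ n * (pi / 2) :> R.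
  by rewrite exprS; field; rewrite gt_eqF.
by rewrite gtr_pMl ?pihalf_gt0// ltr_pdivrMr// mul1r -natrX ltr_nat.
Qed.

(** Pair the angle x with pi / 2 - x: by duplication, twice the sum at level
    n + 1 is four times the sum over the doubled angles.  These are symmetric
    about pi / 2, where 1/sin^2 equals 1, and their halves on either side of it
    both give the sum at level n. *)
Lemma dyadic_csc2S (R : realType) (n : nat) :
  dyadic_csc2 R n.+1 = 4 * dyadic_csc2 R n + 2.
Proof.
have p2 m : (2 ^+ m : R) != 0 by rewrite expf_neq0.
suff : dyadic_csc2 R n.+1 *+ 2 = 4 * (dyadic_csc2 R n *+ 2 + 1).
  by rewrite !mulr2n; lra.
have doubling : dyadic_csc2 R n.+1 *+ 2 =
    4 * \sum_(1 <= k < 2 ^ n.+1) sin (k%:R * pi / 2 ^+ n.+1) ^- 2.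
  rewrite mulr2n {2}/dyadic_csc2 sum_nat_reflect -big_split/= mulr_sumr.
  apply: eq_big_nat => k kn.
  have -> : (2 ^ n.+1 - k)%N%:R * pi / 2 ^+ n.+2 = pi / 2 - k%:R * pi / 2 ^+ n.+2 :> R.
    rewrite natrB; last by case/andP: kn => _ /ltnW.
    by rewrite natrX [2 ^+ n.+2]exprS; field; rewrite p2.
  rewrite csc2_duplication ?dyadic_angle//; congr (4 * sin _ ^- 2).
  by rewrite -mulr_natl [2 ^+ n.+2]exprS; field; rewrite p2.
rewrite doubling; congr (4 * _).
have n2 : (2 ^ n <= 2 ^ n.+1)%N by rewrite leq_exp2l.
rewrite (@big_cat_nat _ _ _ (2 ^ n)) ?expn_gt0//= -/(dyadic_csc2 R n).
rewrite mulr2n -addrA; congr (_ + _).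
rewrite big_ltn ?ltn_exp2l// addrC; congr (_ + _).
  have -> : dyadic_csc2 R n = \sum_(1 <= k < 2 ^ n)
      sin ((2 ^ n + k)%N%:R * pi / 2 ^+ n.+1) ^- 2.
    rewrite /dyadic_csc2 sum_nat_reflect; apply: eq_big_nat => k /andP[_ /ltnW kn].
    rewrite natrB// natrD natrX; congr (_ ^- 2).
    have -> : (2 ^+ n + k%:R) * pi / 2 ^+ n.+1 = k%:R * pi / 2 ^+ n.+1 + pi / 2 :> R.
      by rewrite exprS; field; rewrite p2.
    have -> : (2 ^+ n - k%:R) * pi / 2 ^+ n.+1 = - (k%:R * pi / 2 ^+ n.+1) + pi / 2 :> R.
      by rewrite exprS; field; rewrite p2.
    by rewrite !sinDpihalf cosN.
  rewrite -[X in \sum_(X <= _ < _) _]add1n big_addn expnS mul2n -addnn addnK.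
  by apply: eq_bigr => k _; rewrite addnC.
have -> : (2 ^ n)%N%:R * pi / 2 ^+ n.+1 = pi / 2 :> R.
  by rewrite natrX exprS; field; rewrite p2.
by rewrite sin_pihalf expr1n invr1.
Qed.

Lemma dyadic_csc2E (R : realType) (n : nat) :
  dyadic_csc2 R n = 2 / 3 * (4 ^+ n - 1).
Proof.
elim: n => [|n IH]; first by rewrite /dyadic_csc2 big_geq// expr0 subrr mulr0.
by rewrite dyadic_csc2S IH exprS; field.
Qed.

Definition inv_squares (R : realType) (N : nat) : R :=
  \sum_(1 <= k < N) k%:R ^- 2.

(** Sum the bounds on 1/sin^2 over the angles k pi / 2^(n+1), for which 1/x^2
    is 4^(n+1) / (pi^2 k^2), and divide by 4^(n+1) / pi^2.  The extra term 1 in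
    the upper bound, summed over fewer than 2^n angles, gives the error of order
    2^-n. *)
Lemma inv_squares_dyadic_bounds (R : realType) (n : nat) :
  (1 - 4 ^- n) * (pi ^+ 2 / 6) - 2 ^- n * (pi ^+ 2 / 4) <= inv_squares R (2 ^ n)
    <= (1 - 4 ^- n) * (pi ^+ 2 / 6).
Proof.
have pi0 : pi != 0 :> R by rewrite gt_eqF// pi_gt0.
have p2 : 2 ^+ n != 0 :> R by rewrite expf_neq0.
have four : 4 ^+ n = 2 ^+ n * 2 ^+ n :> R by rewrite -exprMn; congr (_ ^+ n); ring.
have angleE k : (0 < k)%N ->
    (k%:R * (pi : R) / 2 ^+ n.+1) ^- 2 = 4 ^+ n.+1 / pi ^+ 2 * k%:R ^- 2.
  (* Keeps [field] from computing with the choice term that defines pi. *)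
  move=> k0; rewrite !exprS four; move: (pi : R) pi0 => c c0; field.
  by rewrite c0 p2 pnatr_eq0 -lt0n k0.
have lo : 4 ^+ n.+1 / pi ^+ 2 * inv_squares R (2 ^ n) <= dyadic_csc2 R n.
  rewrite mulr_sumr; apply: ler_sum_nat => k kn; rewrite -angleE; last by case/andP: kn.
  by have /andP[] := csc2_bounds (dyadic_angle R kn).
have hi : dyadic_csc2 R n <= 2 ^+ n + 4 ^+ n.+1 / pi ^+ 2 * inv_squares R (2 ^ n).
  apply: (@le_trans _ _ (\sum_(1 <= k < 2 ^ n) (1 + 4 ^+ n.+1 / pi ^+ 2 * k%:R ^- 2))).
    apply: ler_sum_nat => k kn; rewrite -angleE; last by case/andP: kn.
    by have /andP[] := csc2_bounds (dyadic_angle R kn).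
  rewrite big_split/= -mulr_sumr lerD2r sumr_const_nat -natrX ler_nat.
  by rewrite leq_subr.
have w0 : 0 < (pi : R) ^+ 2 / 4 ^+ n.+1 by rewrite divr_gt0 ?exprn_gt0 ?pi_gt0.
have cancel x : pi ^+ 2 / 4 ^+ n.+1 * (4 ^+ n.+1 / pi ^+ 2 * x) = x :> R.
  by rewrite [4 ^+ n.+1]exprS four; move: (pi : R) pi0 => c c0; field; rewrite c0 p2.
move: lo hi; rewrite dyadic_csc2E => lo hi; apply/andP; split.
  rewrite -(ler_pM2l w0) [leRHS]mulrDr cancel -lerBlDl in hi.
  apply: le_trans hi; rewrite le_eqVlt; apply/orP; left; apply/eqP.
  by rewrite [4 ^+ n.+1]exprS four; field; rewrite p2.
rewrite -(ler_pM2l w0) cancel in lo.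
apply: le_trans lo _; rewrite le_eqVlt; apply/orP; left; apply/eqP.
by rewrite [4 ^+ n.+1]exprS four; field; rewrite p2.
Qed.

Lemma cvg_expnl (m : nat) : (1 < m)%N -> (m ^ n)%N @[n --> \oo] --> \oo.
Proof.
move=> m1; apply/cvgnyPge => N; exists N => // n /= Nn.
by apply: leq_trans Nn _; rewrite ltnW// ltn_expl.
Qed.

(** The partial sums increase, so the limit along powers of 2, given by the
    squeeze, is the limit of the whole sequence. *)
Lemma cvg_inv_squares (R : realType) :
  inv_squares R N @[N --> \oo] --> (pi ^+ 2 / 6 : R).
Proof.
have geo (q : R) : 0 <= q < 1 -> q ^+ n @[n --> \oo] --> (0 : R).
  by move=> /andP[q0 q1]; apply: cvg_expr; rewrite ger0_norm.
have g4 : (4 ^- n : R) @[n --> \oo] --> (0 : R).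
  under eq_fun do rewrite -exprVn; apply: geo; lra.
have g2 : (2 ^- n : R) @[n --> \oo] --> (0 : R).
  under eq_fun do rewrite -exprVn; apply: geo; lra.
have up : (1 - 4 ^- n : R) * (pi ^+ 2 / 6) @[n --> \oo] --> (pi ^+ 2 / 6 : R).
  have := cvgM (cvgB (cvg_cst (1 : R)) g4) (cvg_cst (pi ^+ 2 / 6)).
  by rewrite subr0 mul1r; exact.
have low : (1 - 4 ^- n : R) * (pi ^+ 2 / 6) - 2 ^- n * (pi ^+ 2 / 4) @[n --> \oo]
    --> (pi ^+ 2 / 6 : R).
  by have := cvgB up (cvgM g2 (cvg_cst (pi ^+ 2 / 4))); rewrite mul0r subr0; exact.
have dyadic : inv_squares R (2 ^ n) @[n --> \oo] --> (pi ^+ 2 / 6 : R).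
  by apply: squeeze_cvgr low up; apply: nearW => n; exact: inv_squares_dyadic_bounds.
have ndecr : nondecreasing_seq (inv_squares R).
  apply/nondecreasing_seqP => -[|N]; rewrite /inv_squares; first by rewrite !big_geq.
  by rewrite [leRHS]big_nat_recr//= lerDl invr_ge0 exprn_ge0.
have : cvgn (inv_squares R).
  apply: nondecreasing_is_cvgn => //; exists (pi ^+ 2 / 6) => _ [N _ <-].
  apply: le_trans (ndecr _ _ (ltnW (ltn_expl N (isT : 1 < 2)%N))) _.
  have /andP[_ /le_trans] := inv_squares_dyadic_bounds R N; apply.
  by rewrite ler_piMl ?divr_ge0 ?sqr_ge0// gerBl invr_ge0 exprn_ge0.
move=> /cvg_ex[l cl]; rewrite (_ : pi ^+ 2 / 6 = l)//.
by apply: cvg_unique dyadic _ => //; exact: cvg_comp (cvg_expnl _) cl.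
Qed.

Lemma zeta2E (R : realType) : zeta (2 : R) = pi ^+ 2 / 6.
Proof.
rewrite /zeta; apply: cvg_lim => //.
have -> : series (fun k : nat => k.+1%:R `^ (- 2) : R) =
    (fun N => inv_squares R N.+1).
  apply/funext => N; rewrite /series/= /inv_squares big_add1/=.
  by apply: eq_bigr => k _; rewrite powR_invn.
by rewrite (cvg_shiftS (inv_squares R)); exact: cvg_inv_squares.
Qed.

(** * Sieving by finitely many coprime moduli *)

Lemma mul_divnS (e N : nat) : (e %| N.+1)%N -> (e * (N %/ e).+1 = N.+1)%N.
Proof.
case/dvdnP => k Nk.
have e0 : (0 < e)%N by case: e Nk => //; rewrite muln0.
have := divnS N e0; rewrite Nk dvdn_mull// mulnK// add1n => <-.
by rewrite mulnC.
Qed.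

Lemma sum_multiples (V : nmodType) (a : nat -> V) (P : pred nat) (e N : nat) : (0 < e)%N ->
  \sum_(1 <= n < N.+1 | (e %| n)%N && P n) a n =
  \sum_(1 <= m < (N %/ e).+1 | P (e * m)%N) a (e * m)%N.
Proof.
move=> e0; elim: N => [|N IH]; first by rewrite div0n !big_geq.
rewrite big_mkcond big_nat_recr//= -big_mkcond IH divnS//.
have [eN|_] := boolP (e %| N.+1)%N; last by rewrite addr0.
by rewrite add1n [RHS]big_mkcond big_nat_recr//= -big_mkcond mul_divnS.
Qed.

Definition sieved (D : seq nat) (n : nat) : bool := all (fun d => ~~ (d %| n)%N) D.

(** One step of the sieve: the terms to remove are those with n = e m, and as
    e is prime to every d in D, e m avoids D exactly when m does. *)
Lemma sum_sieved_cons (V : zmodType) (a : nat -> V) (e : nat) (D : seq nat) (N : nat) :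
  (0 < e)%N -> all (coprime e) D ->
  \sum_(1 <= n < N.+1 | sieved (e :: D) n) a n =
  \sum_(1 <= n < N.+1 | sieved D n) a n
  - \sum_(1 <= m < (N %/ e).+1 | sieved D m) a (e * m)%N.
Proof.
move=> e0 eD.
rewrite [X in X - _](bigID (fun n => e %| n)%N)/=.
under eq_bigl do rewrite andbC.
under [X in X + _ - _]eq_bigl do rewrite andbC.
rewrite sum_multiples// [X in X + _ - _](_ : _ =
    \sum_(1 <= m < (N %/ e).+1 | sieved D m) a (e * m)%N).
  by rewrite addrAC subrr add0r.
apply: eq_bigl => m; apply: eq_in_all => d dD.
by rewrite Gauss_dvdr// coprime_sym (allP eD).
Qed.

Lemma cvg_divn (e : nat) : (0 < e)%N -> (N %/ e)%N @[N --> \oo] --> \oo.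
Proof.
move=> e0; apply/cvgnyPge => M; exists (M * e)%N => // N /= MN.
by rewrite leq_divRL.
Qed.

(** A sieve step subtracts the sum of 1/(e m)^2, that is 1/e^2 times the
    previous sieved sum, and so multiplies the limit by 1 - 1/e^2. *)
Lemma cvg_sum_sieved_inv_squares (R : realType) (D : seq nat) :
  all (leq 1) D -> pairwise coprime D ->
  \sum_(1 <= n < N.+1 | sieved D n) n%:R ^- 2 @[N --> \oo]
    --> \prod_(d <- D) (1 - d%:R ^- 2) * zeta (2 : R).
Proof.
elim: D => [_ _|e D IH /=/andP[e0 D0] /andP[eD Dco]].
  rewrite big_nil mul1r zeta2E (cvg_shiftS (inv_squares R)).
  exact: cvg_inv_squares.
under eq_fun do rewrite sum_sieved_cons//.
rewrite big_cons -mulrA mulrBl mul1r.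
apply: cvgB; first exact: IH.
have -> : (fun N => \sum_(1 <= m < (N %/ e).+1 | sieved D m) (e * m)%:R ^- 2) =
    (fun N => e%:R ^- 2 * (\sum_(1 <= m < (N %/ e).+1 | sieved D m) m%:R ^- 2)) :> (nat -> R).
  apply/funext => N; rewrite mulr_sumr; apply: eq_bigr => m _.
  by rewrite natrM exprMn invfM.
apply: cvgM; first exact: cvg_cst.
exact: cvg_comp (cvg_divn e0) (IH D0 Dco).
Qed.

(** Telescoping, since 1/n^2 <= 1/(n-1) - 1/n. *)
Lemma inv_squares_tail (R : realType) (z N : nat) : (0 < z <= N)%N ->
  \sum_(z.+1 <= n < N.+1) n%:R ^- 2 <= z%:R^-1 - N%:R^-1 :> R.
Proof.
case/andP => z0; elim: N => [|N IH]; first by rewrite leqn0 => /eqP zE; rewrite zE in z0.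
rewrite leq_eqVlt ltnS => /predU1P[->|zN]; first by rewrite big_geq ?subrr.
rewrite big_nat_recr//=; apply: le_trans (lerD (IH zN) (lexx _)) _.
have N0 : 0 < N%:R :> R by rewrite ltr0n (leq_trans z0).
have N1 : 0 < N.+1%:R :> R by rewrite ltr0n.
have NN : N.+1%:R = N%:R + 1 :> R by rewrite -natr1.
have split_inv : N%:R^-1 = N.+1%:R ^- 2 + N.+1%:R^-1 + (N%:R * N.+1%:R ^+ 2)^-1 :> R.
  by rewrite NN; field; rewrite -NN !gt_eqF.
have : 0 <= (N%:R * N.+1%:R ^+ 2)^-1 :> R.
  by rewrite invr_ge0 mulr_ge0 ?ltW// exprn_gt0.
rewrite split_inv; move: (_ ^- 2) (N.+1%:R^-1) (_^-1) (z%:R^-1) => a b c d ?; lra.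
Qed.

(** * The moduli of the problem and the Euler product *)

Definition primes_upto (z : nat) : seq nat := [seq p <- index_iota 0 z.+1 | prime p].

Lemma mem_primes_upto (z p : nat) : (p \in primes_upto z) = prime p && (p <= z)%N.
Proof. by rewrite mem_filter mem_index_iota. Qed.

Lemma primes_upto_uniq (z : nat) : uniq (primes_upto z).
Proof. by rewrite filter_uniq// iota_uniq. Qed.

(** For a prime p, being divisible by this modulus is what excludes n at p: n
    must be prime to p if p is in S, and prime to p or exactly divisible by p
    otherwise. *)
Definition sieve_modulus (S : {fset nat}) (p : nat) : nat :=
  if p \in S then p else (p ^ 2)%N.

Definition sieve_moduli (S : {fset nat}) (z : nat) : seq nat :=
  map (sieve_modulus S) (primes_upto z).

Lemma sieve_moduli_gt0 (S : {fset nat}) (z : nat) : all (leq 1) (sieve_moduli S z).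
Proof.
apply/allP => _ /mapP[p pz ->]; move: pz; rewrite mem_primes_upto => /andP[/prime_gt0 p0 _].
by rewrite /sieve_modulus; case: ifP => // _; rewrite expn_gt0 p0.
Qed.

Lemma primes_upto_coprime (z : nat) : pairwise coprime (primes_upto z).
Proof.
have := primes_upto_uniq z; rewrite uniq_pairwise.
apply: (@sub_in_pairwise _ prime); last exact: filter_all.
by move=> p q; rewrite -!topredE/= => pp pq; rewrite prime_coprime// dvdn_prime2.
Qed.

Lemma sieve_moduli_coprime (S : {fset nat}) (z : nat) : pairwise coprime (sieve_moduli S z).
Proof.
rewrite pairwise_map; apply: sub_pairwise (primes_upto_coprime z) => p q /= pq.
by rewrite /sieve_modulus; do 2![case: ifP => _]; rewrite ?coprimeXl ?coprimeXr.
Qed.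

(** The middle term is the sum of 1/n^2 over the n without prime factor at most
    z: it contains the term n = 1, and all its other terms have n > z. *)
Lemma euler_partial_bounds (R : realType) (z : nat) : (0 < z)%N ->
  1 <= \prod_(p <- primes_upto z) (1 - p%:R ^- 2) * zeta (2 : R) <= 1 + z%:R^-1.
Proof.
move=> z0.
have primes0 : all (leq 1) (primes_upto z).
  by apply/allP => p; rewrite mem_primes_upto => /andP[/prime_gt0].
have lim := @cvg_sum_sieved_inv_squares R _ primes0 (primes_upto_coprime z).
have nneg (P : pred nat) (m N : nat) : 0 <= \sum_(m <= n < N | P n) n%:R ^- 2 :> R.
  by apply: sumr_ge0 => n _; rewrite invr_ge0 exprn_ge0.
have sieved1 : sieved (primes_upto z) 1.
  apply/allP => p; rewrite mem_primes_upto dvdn1 => /andP[pp _].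
  by rewrite gtn_eqF// prime_gt1.
apply/andP; split; [apply: (cvgr_to_ge lim)|apply: (cvgr_to_le lim)]; near=> N.
  have N1 : (1 < N.+1)%N by rewrite ltnS; near: N; exact: nbhs_infty_ge.
  by rewrite big_mkcond big_ltn// -big_mkcond sieved1 expr1n invr1 lerDl.
have zN : (z <= N)%N by near: N; exact: nbhs_infty_ge.
rewrite big_mkcond big_ltn ?ltnS ?(leq_trans z0)// sieved1 expr1n invr1 lerD2l.
rewrite (@big_cat_nat _ _ _ z.+1) ?ltnS//= big1_seq ?add0r; last first.
  move=> n /andP[_]; rewrite mem_index_iota => /andP[n2 nz]; case: ifP => // n_sieved.
  have pz : pdiv n \in primes_upto z.
    by rewrite mem_primes_upto pdiv_prime//= (leq_trans (pdiv_leq (ltnW n2))).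
  by have := allP n_sieved _ pz; rewrite pdiv_dvd.
apply: (@le_trans _ _ (\sum_(z.+1 <= n < N.+1) n%:R ^- 2)).
  by apply: ler_sum => n _; case: ifP => // _; rewrite invr_ge0 exprn_ge0.
apply: le_trans (@inv_squares_tail R z N _) _; first by rewrite z0.
by rewrite gerBl invr_ge0.
Unshelve. all: by end_near. Qed.

Lemma cvg_euler_product_zeta2 (R : realType) :
  \prod_(p <- primes_upto z) (1 - p%:R ^- 2) @[z --> \oo] --> (zeta (2 : R))^-1.
Proof.
have z2 : 0 < zeta (2 : R) by rewrite zeta2E divr_gt0 ?exprn_gt0 ?pi_gt0.
have lim : \prod_(p <- primes_upto z) (1 - p%:R ^- 2) * zeta (2 : R) @[z --> \oo] --> (1 : R).
  rewrite -(cvg_shiftS (fun z => \prod_(p <- primes_upto z) (1 - p%:R ^- 2) * zeta (2 : R))).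
  apply: (@squeeze_cvgr _ _ _ _ (cst 1) (fun z => 1 + harmonic z)).
  - by apply: nearW => z; exact: euler_partial_bounds.
  - exact: cvg_cst.
  - by have := cvgD (cvg_cst (1 : R)) (@cvg_harmonic R); rewrite addr0; exact.
rewrite -[X in _ --> X]mul1r.
have -> : (fun z => \prod_(p <- primes_upto z) (1 - p%:R ^- 2)) =
    (fun z => \prod_(p <- primes_upto z) (1 - p%:R ^- 2) * zeta (2 : R) / zeta (2 : R)).
  by apply/funext => z; rewrite mulfK ?gt_eqF.
by apply: cvgM lim _; exact: cvg_cst.
Qed.

(** Replacing 1 - 1/p^2 by 1 - 1/p at the primes of S amounts to a factor
    p / (p + 1) for each of them. *)
Lemma sieve_moduli_prod (R : realType) (S : {fset nat}) (z : nat) :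
  (forall p, p \in S -> prime p) -> (forall p, p \in S -> (p <= z)%N) ->
  \prod_(d <- sieve_moduli S z) (1 - d%:R^-1) =
  alpha R S * \prod_(p <- primes_upto z) (1 - p%:R ^- 2).
Proof.
move=> S_prime S_le.
have -> : alpha R S = \prod_(p <- primes_upto z | p \in S) (p%:R / (p%:R + 1)).
  rewrite /alpha -[RHS]big_filter; apply: perm_big; apply: uniq_perm.
  - exact: fset_uniq.
  - by rewrite filter_uniq// primes_upto_uniq.
  - move=> p; rewrite mem_filter mem_primes_upto.
    by have [pS|//] := boolP (p \in S); rewrite S_prime// S_le.
rewrite big_map [X in _ = X * _]big_mkcond -big_split/= !big_seq.
apply: eq_bigr => p; rewrite mem_primes_upto => /andP[/prime_gt0 p0 _].
rewrite /sieve_modulus; case: ifP => _; last by rewrite natrX mul1r.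
have pp : p%:R != 0 :> R by rewrite pnatr_eq0 -lt0n.
have pp1 : p%:R + 1 != 0 :> R by rewrite natr1 pnatr_eq0.
by field; rewrite pp.
Qed.

(** Union bound: for each k > z there are at most N / k^2 multiples of k^2, and
    the sum of 1/k^2 over k > z is at most 1/z. *)
Lemma count_large_square_divisor (R : realType) (P : pred nat) (z N : nat) : (0 < z)%N ->
  (forall n, (0 < n)%N -> P n -> exists2 k, (z < k)%N & (k ^ 2 %| n)%N) ->
  (\sum_(1 <= n < N.+1 | P n) 1)%N%:R <= N%:R / z%:R :> R.
Proof.
move=> z0 Pz.
have [Nz|zN] := leqP N z.
  (* Here k^2 > k > z >= N >= n, so no n is counted. *)
  rewrite big_nat_cond big1 ?divr_ge0// => n /andP[/andP[n0 nN] /(Pz n n0)[k zk /dvdn_leq]].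
  move=> /(_ n0) kn; have := leq_trans (ltn_expl k (ltnSn 1)) _; nia.
have count_le : (\sum_(1 <= n < N.+1 | P n) 1 <= \sum_(z.+1 <= k < N.+1) N %/ k ^ 2)%N.
  have -> : (\sum_(z.+1 <= k < N.+1) N %/ k ^ 2 =
      \sum_(z.+1 <= k < N.+1) \sum_(1 <= n < N.+1 | k ^ 2 %| n) 1)%N.
    apply: eq_big_nat => k /andP[zk _].
    have := @sum_multiples nat (fun=> 1%N) xpredT (k ^ 2) N.
    rewrite expn_gt0 (leq_ltn_trans _ zk)//= sum_nat_const_nat subn1 muln1 /= => <- //.
    by apply: eq_bigl => n; rewrite andbT.
  rewrite (exchange_big_dep xpredT)//= big_mkcond big_nat_cond [leqRHS]big_nat_cond.
  apply: leq_sum => n /andP[/andP[n0 nN] _].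
  case: ifP => // /(Pz n n0)[k zk kn].
  have kN : (k <= n)%N.
    apply: leq_trans (dvdn_leq n0 kn).
    by rewrite -mulnn leq_pmulr// (leq_ltn_trans _ zk).
  rewrite big_mkcond (bigD1_seq k) ?iota_uniq//= ?kn//.
  by rewrite mem_index_iota zk (leq_ltn_trans kN).
move: count_le; rewrite -(ler_nat R) => /le_trans; apply.
apply: (@le_trans _ _ (\sum_(z.+1 <= k < N.+1) N%:R * k%:R ^- 2)).
  rewrite natr_sum; apply: ler_sum_nat => k /andP[zk _].
  have k0 : (0 < k)%N by apply: leq_ltn_trans zk.
  by rewrite ler_pdivlMr ?exprn_gt0 ?ltr0n// -natrX -natrM ler_nat leq_divM.
rewrite -mulr_sumr ler_wpM2l//.
apply: le_trans (@inv_squares_tail R z N _) _; first by rewrite z0 ltnW.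
by rewrite gerBl invr_ge0.
Qed.

(** * Averages of complex-valued functions *)

Lemma normCR (R : realType) (x : R) : `|x%:C| = `|x|%:C.
Proof. by rewrite normc_def/= expr0n addr0 sqrtr_sqr. Qed.

Lemma cvg_real_complex (R : realType) (u : nat -> R) (l : R) :
  u n @[n --> \oo] --> l -> ((u n)%:C : (R[i])^o) @[n --> \oo] --> (l%:C : (R[i])^o).
Proof.
move=> /cvgrPdist_lt ul; apply/cvgrPdist_lt => e e0.
have eR : e = (complex.Re e)%:C by apply/esym/RRe_real; rewrite gtr0_real.
have re0 : 0 < complex.Re e by rewrite -ltcR -eR.
near=> n; rewrite -rmorphB eR normCR ltcR; near: n; exact: ul.
Unshelve. all: by end_near. Qed.

(** Exchange of limits: the double sequence y z N has limits l z in N, and is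
    close to x N uniformly in N once z is large. *)
Lemma cvg_uniform_approx (K : numFieldType) (V : normedModType K)
    (x : nat -> V) (y : nat -> nat -> V) (l : nat -> V) (L : V) (t : nat -> K) :
  (forall z, y z N @[N --> \oo] --> l z) ->
  l z @[z --> \oo] --> L ->
  t z @[z --> \oo] --> (0 : K) ->
  (\forall z \near \oo, forall N, `|x N - y z N| <= t z) ->
  x N @[N --> \oo] --> L.
Proof.
move=> yl /cvgrPdist_lt lL /cvgrPdist_lt t0 xy; apply/cvgrPdist_lt => e e0.
have e3 : 0 < e / 3 by rewrite divr_gt0.
near \oo => z.
have Lz : `|L - l z| < e / 3 by near: z; exact: lL.
have tz : `|t z| < e / 3 by rewrite -normrN -sub0r; near: z; exact: t0.
have xyz N : `|x N - y z N| <= t z by move: N; near: z.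
have /cvgrPdist_lt lz := yl z.
near=> N.
have ly : `|l z - y z N| < e / 3 by near: N; exact: lz.
rewrite -(subrKA (l z)) -(subrKA (y z N) (l z)).
apply: le_lt_trans (ler_normD _ _) _.
apply: le_lt_trans (lerD (lexx _) (ler_normD _ _)) _.
have -> : e = e / 3 + (e / 3 + e / 3) by field.
apply: ltrD => //; apply: ltrD => //; rewrite distrC.
apply: le_lt_trans (xyz N) _; apply: le_lt_trans tz.
by rewrite ger0_norm// (le_trans _ (xyz N)).
Unshelve. all: by end_near. Qed.

Lemma cvg_divn_ratio (R : realType) (e : nat) : (0 < e)%N ->
  (N %/ e)%N%:R / N%:R @[N --> \oo] --> (e%:R^-1 : R).
Proof.
move=> e0; have e0R : 0 < e%:R :> R by rewrite ltr0n.
apply: (@squeeze_cvgr _ _ _ _ (fun N => e%:R^-1 - N%:R^-1) (cst e%:R^-1)); last 2 first.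
- have := cvgB (cvg_cst (e%:R^-1 : R)) (@cvg_harmonic R).
  rewrite subr0 -(cvg_shiftS (fun N => e%:R^-1 - N%:R^-1 : R)); exact.
- exact: cvg_cst.
near=> N; have N0 : 0 < N%:R :> R by rewrite ltr0n; near: N; exact: nbhs_infty_gt.
apply/andP; split.
  rewrite ler_pdivlMr// mulrBl mulVf ?gt_eqF// lerBlDr -(ler_pM2l e0R).
  by rewrite mulrA divff ?gt_eqF// mul1r natr1 -natrM ler_nat mulnC ltnW// ltn_ceil.
by rewrite ler_pdivrMr// mulrC ler_pdivlMr// -natrM ler_nat leq_divM.
Unshelve. all: by end_near. Qed.

Lemma averageE (R : realType) (P : pred nat) (a : nat -> R[i]) (N : nat) :
  average P a N = N%:R^-1 * \sum_(1 <= n < N.+1 | P n) a n.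
Proof. by rewrite /average; under eq_bigl do rewrite asboolb. Qed.

Lemma average_sieved_cons (R : realType) (a : nat -> R[i]) (e : nat) (D : seq nat) (N : nat) :
  (0 < e)%N -> all (coprime e) D ->
  average (sieved (e :: D)) a N =
  average (sieved D) a N
  - ((N %/ e)%N%:R / N%:R)%:C * average (sieved D) (fun n => a (e * n)%N) (N %/ e)%N.
Proof.
move=> e0 eD; rewrite !averageE sum_sieved_cons// mulrBr; congr (_ - _).
have [->|Ne] := posnP (N %/ e)%N; first by rewrite big_geq// !mulr0.
rewrite mulrA; congr (_ * _); rewrite fmorph_div !rmorph_nat mulrAC divff ?mul1r//.
by rewrite pnatr_eq0 -lt0n.
Qed.

(** The induction has to let a vary: a sieve step brings in n |-> a (e n), which
    inherits the invariance hypothesis with the same A, and the factor 1/e is the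
    limit of (N / e) / N. *)
Lemma cvg_average_sieved (R : realType) (D : seq nat) (a : nat -> R[i]) (A : R[i]) :
  all (leq 1) D -> pairwise coprime D ->
  (forall m : nat, (0 < m)%N ->
      average (fun=> True) (fun n => a (m * n)%N) N @[N --> \oo] --> (A : (R[i])^o)) ->
  average (sieved D) a N @[N --> \oo]
    --> ((\prod_(d <- D) (1 - d%:R^-1) : R)%:C * A : (R[i])^o).
Proof.
elim: D a => [|e D IH] a.
  move=> _ _ /(_ 1%N isT); rewrite big_nil mul1r.
  have -> : (fun n => a (1 * n)%N) = a by apply/funext => n; rewrite mul1n.
  have -> // : (fun n => sieved [::] n : Prop) = (fun=> True).
  by apply/funext => n; apply/propext.
move=> /=/andP[e0 D0] /andP[eD Dco] aA.
under eq_fun do rewrite average_sieved_cons//.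
rewrite big_cons mulrBl mul1r rmorphB mulrBl rmorphM -mulrA.
apply: cvgB; first exact: IH.
suff sieved_multiples : average (sieved D) (fun n => a (e * n)%N) M @[M --> \oo]
    --> ((\prod_(d <- D) (1 - d%:R^-1) : R)%:C * A : (R[i])^o).
  apply: (cvgM (cvg_real_complex (@cvg_divn_ratio R e e0))).
  exact: cvg_comp (cvg_divn e0) sieved_multiples.
apply: IH => // m m0; have := aA (e * m)%N; rewrite muln_gt0 e0 => /(_ m0).
have -> // : (fun n => a (e * m * n)%N) = (fun n => a (e * (m * n))%N).
by apply/funext => n; rewrite mulnA.
Qed.

(** * From finitely many primes to all primes *)

Definition squarefree_away (S : {fset nat}) (n : nat) : Prop :=
  squarefree n /\ forall p : nat, p \in S -> ~~ (p %| n)%N.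

Lemma squarefree_away_sieved (S : {fset nat}) (z n : nat) :
  squarefree_away S n -> sieved (sieve_moduli S z) n.
Proof.
move=> [[_ sqf] away]; apply/allP => _ /mapP[p + ->]; rewrite mem_primes_upto => /andP[pp _].
by rewrite /sieve_modulus; case: ifP => [/away|_] //; exact: sqf.
Qed.

(** The primes of S being at most z, they are all taken into account by the
    truncated sieve, which can only miss a square of a prime beyond z. *)
Lemma sieved_large_square_divisor (S : {fset nat}) (z n : nat) :
  (forall p, p \in S -> prime p) -> (forall p, p \in S -> (p <= z)%N) -> (0 < n)%N ->
  sieved (sieve_moduli S z) n -> ~ squarefree_away S n ->
  exists2 p, (z < p)%N & (p ^ 2 %| n)%N.
Proof.
move=> S_prime S_le n0 n_sieved; apply: contra_notP => no_square.
have modulus_ndvd p : prime p -> (p <= z)%N -> ~~ (sieve_modulus S p %| n)%N.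
  by move=> pp pz; apply: (allP n_sieved); rewrite map_f// mem_primes_upto pp.
have away p : p \in S -> ~~ (p %| n)%N.
  by move=> pS; have := modulus_ndvd p (S_prime p pS) (S_le p pS); rewrite /sieve_modulus pS.
split; last exact: away; split=> // p pp; apply/negP => pn.
have [zp|pz] := ltnP z p; first by apply: no_square; exists p.
have := modulus_ndvd p pp pz; rewrite /sieve_modulus; case: ifP => [/away|_]; last by rewrite pn.
by rewrite (dvdn_trans (dvdn_mulr p (dvdnn p)) pn).
Qed.

(** The two sums differ by the terms that survive the truncated sieve without
    being squarefree and prime to S; each has a square divisor k^2 with k > z. *)
Lemma average_sieve_error (R : realType) (a : nat -> R[i]) (M : R) (S : {fset nat}) (z N : nat) :
  (forall n : nat, (0 < n)%N -> `|a n| <= M%:C) ->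
  (forall p, p \in S -> prime p) -> (forall p, p \in S -> (p <= z)%N) -> (0 < z)%N ->
  `|average (squarefree_away S) a N - average (sieved (sieve_moduli S z)) a N|
    <= (M / z%:R)%:C.
Proof.
move=> aM S_prime S_le z0.
have M0 : 0 <= M by have := le_trans (normr_ge0 _) (aM 1%N isT); rewrite lecR.
rewrite averageE /average -mulrBr.
rewrite [X in _ - X](bigID (fun n => `[< squarefree_away S n >]))/=.
rewrite [X in X - _](_ : _ = \sum_(1 <= n < N.+1 | sieved (sieve_moduli S z) n &&
    `[< squarefree_away S n >]) a n); last first.
  apply: eq_bigl => n; case: asboolP => [/(squarefree_away_sieved z)->//|].
  by rewrite andbF.
rewrite opprD addrA subrr add0r normrM normrN normfV normr_nat.
have [->|N0] := posnP N; first by rewrite invr0 mul0r lecR divr_ge0.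
pose Q n := sieved (sieve_moduli S z) n && ~~ `[< squarefree_away S n >].
have count_le : (\sum_(1 <= n < N.+1 | Q n) 1)%N%:R <= N%:R / z%:R :> R.
  apply: count_large_square_divisor => // n n0 /andP[n_sieved /asboolPn].
  exact: sieved_large_square_divisor.
apply: (@le_trans _ _ (N%:R^-1 * (M * (\sum_(1 <= n < N.+1 | Q n) 1)%N%:R)%:C)).
  rewrite ler_wpM2l ?invr_ge0//; apply: le_trans (ler_norm_sum _ _ _) _.
  rewrite natr_sum mulr_sumr rmorph_sum/= big_nat_cond [leRHS]big_nat_cond.
  by apply: ler_sum => n /andP[/andP[n0 _] _]; rewrite mulr1 aM.
rewrite -(rmorph_nat (real_complex R)) -fmorphV -rmorphM lecR.
apply: (@le_trans _ _ (N%:R^-1 * (M * (N%:R / z%:R)))).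
  by rewrite !ler_wpM2l ?invr_ge0.
by rewrite mulrCA [N%:R^-1 * _]mulrA mulVf ?mul1r// pnatr_eq0 -lt0n.
Qed.

Theorem theorem1p1 (R : realType) (a : nat -> R[i]) (A : R[i])
    (a_bounded : exists M : R, forall n : nat, (0 < n)%N -> `|a n| <= M%:C)
    (a_average : average (fun=> True) a N @[N --> \oo] --> (A : (R[i])^o))
    (a_invariant : forall m : nat, (0 < m)%N ->
      average (fun=> True) (fun n => a (m * n)%N) N @[N --> \oo]
        --> (A : (R[i])^o)) :
  (forall S : {fset nat}, (forall p : nat, p \in S -> prime p) ->
    average (fun n => squarefree n /\ forall p : nat, p \in S -> ~~ (p %| n)%N)
        a N @[N --> \oo]
      --> ((alpha R S / zeta 2)%:C * A : (R[i])^o)) /\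
  average squarefree a N @[N --> \oo] --> ((6 / pi ^+ 2)%:C * A : (R[i])^o).
Proof.
have [M aM] := a_bounded.
have main S : (forall p : nat, p \in S -> prime p) ->
    average (squarefree_away S) a N @[N --> \oo]
      --> ((alpha R S / zeta 2)%:C * A : (R[i])^o).
  move=> S_prime.
  have S_le : \forall z \near \oo, forall p, p \in S -> (p <= z)%N.
    exists (\max_(p <- S) p)%N => // z /= Sz p pS.
    by apply: leq_trans Sz; exact: leq_bigmax_seq.
  apply: (@cvg_uniform_approx _ _ _
    (fun z => average (sieved (sieve_moduli S z)) a)
    (fun z => (\prod_(d <- sieve_moduli S z) (1 - d%:R^-1) : R)%:C * A) _
    (fun z => (M / z%:R)%:C)).
  - move=> z; apply: cvg_average_sieved => //.
    + exact: sieve_moduli_gt0.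
    + exact: sieve_moduli_coprime.
  - apply: cvgM; last exact: cvg_cst.
    apply: cvg_real_complex.
    apply: cvg_trans (cvgM (cvg_cst (alpha R S)) (@cvg_euler_product_zeta2 R)).
    by apply: near_eq_cvg; near=> z; rewrite /= sieve_moduli_prod//; near: z.
  - apply: (@cvg_real_complex R (fun z => M / z%:R) 0).
    rewrite -(cvg_shiftS (fun z => M / z%:R)).
    by have := cvgM (cvg_cst M) (@cvg_harmonic R); rewrite mulr0; exact.
  - near=> z => N.
    have Sz : forall p, p \in S -> (p <= z)%N by near: z.
    have z0 : (0 < z)%N by near: z; exact: nbhs_infty_gt.
    exact: average_sieve_error.
split=> [S|]; first exact: main.
have -> : squarefree = squarefree_away fset0.
  by apply/funext => n; apply/propext; split=> [?|[]].
have <- : alpha R fset0 / zeta 2 = 6 / pi ^+ 2.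
  by rewrite /alpha big_seq_fset0 mul1r zeta2E invf_div.
by apply: main => p; rewrite in_fset0.
Unshelve. all: by end_near. Qed.
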